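(* Let $n\geq 2$ be a positive integer. Then $$\det(\mathrm{rcir}(\boldsymbol{c}_n(i)))=\begin{cases}0 & \text{if } n\equiv 0 \pmod 4,\\ (2i)^{\frac{n-1}{2}} & \text{if } n\equiv 1\pmod 4,\\ 2^{n-1} & \text{if } n\equiv 2\pmod 4,\\ -(2i)^{\frac{n-1}{2}} & \text{if } n\equiv 3\pmod 4.\end{cases}$$
   Context: Here $i$ is the imaginary unit. For $\boldsymbol{a}=(a_0,a_1,\dots,a_{n-1})\in\mathbb{C}^n$, $\mathrm{rcir}(\boldsymbol{a})$ denotes the $n\times n$ complex right circulant matrix with first row $\boldsymbol{a}$, each subsequent row being the preceding row rotated one position to the right; i.e., indexing rows and columns by $0,\dots,n-1$, its $(j,k)$ entry is $a_{(k-j)\bmod n}$. For a nonzero complex number $z$, $\boldsymbol{c}_n(z)=\left(\binom{n-1}{0}z^0,\binom{n-1}{1}z^1,\dots,\binom{n-1}{n-1}z^{n-1}\right)\in\mathbb{C}^n$ is the vector of coefficients of $(x+zy)^{n-1}$. *)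

(* Defs.v *)
From mathcomp Require Export all_boot all_order all_algebra.
From mathcomp Require Export reals complex.

Set Implicit Arguments.
Unset Strict Implicit.
Unset Printing Implicit Defensive.

Import GRing.Theory.
Local Open Scope ring_scope.

Fact rot_idx_subproof (n : nat) (j k : 'I_n) : ((k + (n - j)) %% n < n)%N.
Proof. by rewrite ltn_pmod //; apply: leq_ltn_trans (ltn_ord j). Qed.

(* (k - j) mod n; since j < n, the truncated subtraction n - j is exact. *)
Definition rot_idx (n : nat) (j k : 'I_n) : 'I_n :=
  Ordinal (rot_idx_subproof j k).

Definition rcir (T : Type) (n : nat) (a : 'rV[T]_n) : 'M[T]_n :=
  \matrix_(j < n, k < n) a ord0 (rot_idx j k).

Definition binom_row (K : pzRingType) (n : nat) (z : K) : 'rV[K]_n :=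
  \row_(k < n) ('C(n.-1, k)%:R * z ^+ k).

(* Main.v *)
Require Import Defs.
From mathcomp Require Import zify.

Set Implicit Arguments.
Unset Strict Implicit.
Unset Printing Implicit Defensive.

Import GRing.Theory.
Local Open Scope ring_scope.

(* Let P be the permutation matrix of the n-cycle j |-> j + 1.  By the binomial
   theorem rcir(c_n(z)) = (1 + z P)^(n-1), and Laplace expansion along column 0
   gives det(1 + z P) = 1 - (-z)^n over any commutative ring.  It remains to
   evaluate (1 - (-i)^n)^(n-1), using (1 + i)^2 = 2i and (1 - i)^2 = -2i. *)

Definition shift_mx (K : pzSemiRingType) (n : nat) : 'M[K]_n :=
  \matrix_(j < n, k < n) (k == ordS j)%:R.

Lemma val_iter_ordS (n m : nat) (j : 'I_n) :
  iter m (@ordS n) j = ((j + m) %% n)%N :> nat.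
Proof.
elim: m => [|m IHm] /=; first by rewrite addn0 modn_small.
by rewrite IHm -addn1 modnDml addn1 addnS.
Qed.

(** This matches the support of the [m]-th power of the shift with the positions where a circulant
    carries its [m]-th coefficient. Both sides become the same congruence once [n - j] is added. *)
Lemma iter_ordS_eq (n : nat) (j k m : 'I_n) :
  (k == iter m (@ordS n) j) = (rot_idx j k == m).
Proof.
rewrite -!val_eqE /= val_iter_ordS.
have [hj hk hm] := And3 (ltn_ord j) (ltn_ord k) (ltn_ord m).
rewrite -{1}(modn_small hk) -{2}(modn_small hm) -(eqn_modDr (n - j)%N).
by have -> : (j + m + (n - j) = m + n)%N; [lia | rewrite modnDr].
Qed.

Lemma scale_shift_mxX (K : comPzRingType) (n m : nat) (z : K) (j k : 'I_n) :
  ((z *: shift_mx K n) ^+ m) j k = z ^+ m * (k == iter m (@ordS n) j)%:R.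
Proof.
elim: m k => [|m IHm] k; first by rewrite !expr0 mul1r mxE eq_sym.
rewrite exprSr mxE (bigD1 (iter m (@ordS n) j)) //= IHm eqxx mulr1 !mxE.
rewrite mulrA -exprSr big1 ?addr0 // => l /negPf ne_l.
by rewrite IHm ne_l mulr0 mul0r.
Qed.

(** The shift powers with exponents 0 to [n.-1] have disjoint supports covering all positions, so
    each entry receives exactly one binomial term, that of exponent [rot_idx j k]. *)
Lemma rcir_binom_rowE (K : comPzRingType) (n : nat) (z : K) :
  rcir (binom_row n z) = (1 + z *: shift_mx K n) ^+ n.-1.
Proof.
case: n => [|n]; first by apply/matrixP => - [].
rewrite exprDn_comm; last exact: commr_sym (commr1 _).
apply/matrixP => j k; rewrite !mxE summxE.
under [RHS]eq_bigr => m _ do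
  rewrite expr1n mul1r -scaler_nat mxE scale_shift_mxX iter_ordS_eq.
rewrite (bigD1 (rot_idx j k)) //= eqxx mulr1 big1 ?addr0 // => m.
by rewrite eq_sym => /negPf->; rewrite !mulr0.
Qed.

Lemma detX (K : comPzRingType) (n m : nat) (A : 'M[K]_n) :
  \det (A ^+ m) = \det A ^+ m.
Proof.
by elim: m => [|m IHm]; rewrite ?expr0 ?det1 // !exprS -IHm -det_mulmx.
Qed.

(** Column 0 has only a 1 in its first row and [z] in its last; size at least 2 keeps these rows
    distinct. The first minor is upper triangular with diagonal 1, the second lower triangular with
    diagonal [z] and sign [(-1) ^+ n.+1]. *)
Lemma det_1Dshift_mx (K : comPzRingType) (n : nat) (z : K) :
  \det (1 + z *: shift_mx K n.+2) = 1 - (- z) ^+ n.+2.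
Proof.
set A := 1 + _.
have AE (j k : 'I_n.+2) : A j k =
    (j == k :> nat)%:R + z * (k == (if (j < n.+1)%N then j.+1 else 0) :> nat)%:R.
  rewrite !mxE -!val_eqE /=; case: ltnP => [lt_j|le_j].
    by rewrite modn_small.
  by rewrite (_ : j.+1 = n.+2) ?modnn //; have := ltn_ord j; lia.
clearbody A.
have up (i : 'I_n.+1) : lift ord0 i = i.+1 :> nat by [].
have down (i : 'I_n.+1) : lift (@ord_max n.+1) i = i :> nat.
  by rewrite /= /bump leqNgt ltn_ord.
(* Each entry is decided by two tests: [b] for the diagonal, [c] for the cyclic superdiagonal. *)
have entry (j k : 'I_n.+2) b c : (j == k :> nat) = b ->
    ((k : nat) == if (j < n.+1)%N then j.+1 else 0%N) = c ->
    A j k = b%:R + z * c%:R.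
  by move=> <- <-.
rewrite (expand_det_col _ ord0) big_ord_recl big_ord_recr /= big1 => [|i _].
  rewrite add0r; have -> : lift ord0 ord_max = @ord_max n.+1 by apply: val_inj.
  rewrite !AE /= ltnn mulr0 addr0 mul1r add0r mulr1.
  (* [det_trig] expects a lower triangular matrix, so the upper triangular minor is transposed
     first. *)
  rewrite /cofactor expr0 mul1r addn0 -det_tr !det_trig.
  - rewrite big1 => [|i _]; last first.
      rewrite !mxE (@entry _ _ true false) ?mulr0 ?addr0 ?eqxx // !up.
      by case: ifP; lia.
    rewrite (eq_bigr (fun=> z)) => [|i _].
      by rewrite prodr_const card_ord -exprNn [in RHS]exprS mulNr opprK.
    rewrite !mxE (@entry _ _ false true) ?mulr1 ?add0r // up down; first lia.
    by rewrite ltn_ord eqxx.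
  - apply/is_trig_mxP => /= i j lt_ij; rewrite !mxE.
    by rewrite (@entry _ _ false false) ?mulr0 ?addr0 // up down;
      [lia|rewrite ltn_ord; lia].
  - apply/is_trig_mxP => /= i j lt_ij; rewrite !mxE.
    rewrite (@entry _ _ false false) ?mulr0 ?addr0 // !up; first lia.
    by case: ifP; lia.
(* The rows strictly between first and last vanish in column 0. *)
rewrite (@entry _ _ false false) ?mulr0 ?addr0 ?mul0r //=.
by rewrite /= ltnS ltn_ord.
Qed.

Theorem theorem3p11 (R : realType) (n : nat) (hn : (2 <= n)%N) :
  let D : R[i] := \det (rcir (binom_row n ('i%C : R[i]))) in
  [/\ n = 0 %[mod 4] -> D = 0,
      n = 1 %[mod 4] -> D = (2 * 'i%C) ^+ ((n - 1) %/ 2),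
      n = 2 %[mod 4] -> D = 2 ^+ (n - 1)
    & n = 3 %[mod 4] -> D = - (2 * 'i%C) ^+ ((n - 1) %/ 2)].
Proof.
case: n hn => [|[|n]] // _ D.
have i2 : ('i%C : R[i]) ^+ 2 = -1 by rewrite sqr_i.
have i4 : (- 'i%C : R[i]) ^+ 4 = 1 by rewrite (exprM _ 2 2) sqrrN i2 sqrrN expr1n.
have iX r : (r < 4)%N -> n.+2 = r %[mod 4] ->
    (- 'i%C : R[i]) ^+ n.+2 = (- 'i%C) ^+ r.
  by move=> lt_r4 nE; rewrite -(expr_mod _ i4) nE modn_small.
have {D}-> : D = (1 - (- 'i%C) ^+ n.+2) ^+ (n.+2 - 1).
  by rewrite /D rcir_binom_rowE subn1 detX det_1Dshift_mx.
have halfE : odd n.+2 -> (n.+2 - 1 = 2 * ((n.+2 - 1) %/ 2))%N by lia.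
split=> nE; rewrite (iX _ _ nE) //.
(* The exponent is positive, so the power of 0 is 0 and not 1. *)
- by rewrite expr0 subrr expr0n.
- rewrite expr1 opprK {1}halfE; last lia.
  rewrite exprM sqrrD i2 expr1n mul1r addrAC subrr add0r.
  by rewrite -mulr_natl.
- by rewrite sqrrN i2 opprK.
- rewrite exprS sqrrN i2 mulrN1 opprK {1}halfE; last lia.
  rewrite exprM sqrrB i2 expr1n mul1r addrAC subrr add0r.
  rewrite -mulr_natl exprNn -signr_odd.
  (* As [n.+2] is 3 modulo 4, this exponent of -2i is odd and the sign survives. *)
  by have -> : odd ((n.+2 - 1) %/ 2); [lia | rewrite mulN1r].
Qed.
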